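(* Let $\varepsilon>0$, and let $u=(u_1,\dots,u_{N_h})^\top\in\mathbb{R}^{N_h}$ be a solution of the nonlinear well-balanced monolithic convex limiting (WMC) problem, i.e. $$a_i^Ru_i-\sum_{j\in\mathcal N_i\setminus\{i\}}\big[2d_{ij}(\bar u_{ij}^{s,*}-u_i)-a_{ij}^D(u_j-u_i)\big]=0\quad (i=1,\dots,M_h),\qquad u_i=u_D(\mathbf{x}_i)\quad (i=M_h+1,\dots,N_h).$$ Then the following local discrete maximum principles hold for any $i\in\{1,\dots,M_h\}$: $$b_i\le 0\ \Rightarrow\ u_i\le\max_{j\in\mathcal N_i\setminus\{i\}}u_j^+,\qquad b_i\ge 0\ \Rightarrow\ u_i\ge\min_{j\in\mathcal N_i\setminus\{i\}}u_j^-,$$ where $u_j^+=\max\{u_j,0\}$ and $u_j^-=\min\{u_j,0\}$. If $a_i^R=0$, then the following stronger local discrete maximum principles hold: $$b_i\le 0\ \Rightarrow\ u_i\le\max_{j\in\mathcal N_i\setminus\{i\}}u_j,\qquad b_i\ge 0\ \Rightarrow\ u_i\ge\min_{j\in\mathcal N_i\setminus\{i\}}u_j.$$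
   Context: **Problem data.** $d\in\{1,2,3\}$; $\Omega\subset\mathbb{R}^d$ is a domain with Lipschitz boundary $\Gamma=\partial\Omega$. The continuous problem is $-\varepsilon\Delta u+\mathbf{v}\cdot\nabla u+cu=f$ in $\Omega$, $u=u_D$ on $\Gamma_D$, with constant diffusion coefficient $\varepsilon$, given velocity field $\mathbf{v}=\mathbf{v}(\mathbf{x})$, nonnegative reaction rate $c=c(\mathbf{x})$, source term $f=f(\mathbf{x})$, and Dirichlet data $u_D$. For $\varepsilon>0$ one has $\Gamma_D=\Gamma$. No continuity of the data is assumed; the integrals and the values at mesh vertices used below are simply taken to be given. **Mesh and finite elements.** $\mathcal T_h$ is a conforming simplex mesh with $\bigcup_{K\in\mathcal T_h}K=\overline\Omega$, vertices $\mathbf{x}_1,\dots,\mathbf{x}_{N_h}$, maximal cell diameter $h>0$. $\varphi_j\in C(\overline\Omega)$ are the piecewise linear Lagrange basis functions, $\varphi_j|_K\in\mathbb{P}_1(K)$ for all $K\in\mathcal T_h$, $\varphi_j(\mathbf{x}_i)=\delta_{ij}$. A vector $u=(u_1,\dots,u_{N_h})^\top$ is identified with $u_h=\sum_{j=1}^{N_h}u_j\varphi_j$. The Dirichlet boundary nodes are those with indices $M_h+1,\dots,N_h$. $\mathcal N_i$ is the set of indices $j$ such that $\varphi_i,\varphi_j$ have overlapping supports, i.e. $\mathbf{x}_i,\mathbf{x}_j$ belong to a common mesh cell (so $i\in\mathcal N_i$). **Matrices.** $a_{ij}^D=\varepsilon\int_\Omega\nabla\varphi_i\cdot\nabla\varphi_j\,d\mathbf{x}$,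 $a_{ij}^C=\int_\Omega\varphi_i\,\mathbf{v}\cdot\nabla\varphi_j\,d\mathbf{x}$, $a_{ij}^R=\int_\Omega c\,\varphi_i\varphi_j\,d\mathbf{x}$, $b_i=\int_\Omega\varphi_i f\,d\mathbf{x}$, $a_i^R=\sum_{j\in\mathcal N_i}a_{ij}^R$. With a fixed small constant $\delta>0$, for $j\in\mathcal N_i\setminus\{i\}$: $d_{ij}=\max\{|a_{ij}^C|,\delta h^{d-1},|a_{ji}^C|\}$ (and $d_{ij}=0$ if $j\notin\mathcal N_i$, $d_{ii}=-\sum_{k\in\mathcal N_i\setminus\{i\}}d_{ik}$); $a_i^C=\sum_{j\in\mathcal N_i\setminus\{i\}}2d_{ij}>0$. **Standing assumptions.** $a_{ij}^D\le 0$ for all $i\ne j$ in $\{1,\dots,N_h\}$; $|\mathbf{v}(\mathbf{x}_i)|+|\mathbf{v}(\mathbf{x}_j)|>0$ for all $i\in\{1,\dots,N_h\}$ and $j\in\mathcal N_i\setminus\{i\}$ ($|\cdot|$ Euclidean norm). **Well-balanced (WMC) scheme.** The quantities below that involve nodal values are functions of $u\in\mathbb{R}^{N_h}$. For $i=1,\dots,N_h$ and $j\in\mathcal N_i\setminus\{i\}$, with $s_i=f(\mathbf{x}_i)-c(\mathbf{x}_i)u_i$, $$\bar u_{ij}=\frac{u_j+u_i}{2}-\frac{a_{ij}^C(u_j-u_i)}{2d_{ij}},\qquad P_{ij}=\frac12\,\frac{s_i+s_j}{2}\,\frac{(\mathbf{x}_i-\mathbf{x}_j)\cdot(\mathbf{v}(\mathbf{x}_i)+\mathbf{v}(\mathbf{x}_j))}{2(\max\{|\mathbf{v}(\mathbf{x}_i)|,|\mathbf{v}(\mathbf{x}_j)|\})^2}.$$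 For $i\le M_h$, $j\in\mathcal N_i\setminus\{i\}$, fix a mesh cell $K_j^i$ containing $\mathbf{x}_i$ that is intersected by the half line $\{\mathbf{x}_i+\theta(\mathbf{x}_i-\mathbf{x}_j):\theta>0\}$, and set $u_j^i=u_i+\nabla u_h|_{K_j^i}\cdot(\mathbf{x}_i-\mathbf{x}_j)$. Define, for $i\le M_h$, $$Q_{ij}^+=\max\Big\{\tfrac{u_j^i-u_i}{2},\max\{u_i,u_j\}-\bar u_{ij}-\tfrac{b_i}{a_i^C}\Big\},\quad Q_{ij}^-=\min\Big\{\tfrac{u_j^i-u_i}{2},\min\{u_i,u_j\}-\bar u_{ij}-\tfrac{b_i}{a_i^C}\Big\},$$ $R_{ij}=Q_{ij}^+/P_{ij}$ if $b_i\le0$ and $P_{ij}>Q_{ij}^+$; $R_{ij}=Q_{ij}^-/P_{ij}$ if $b_i\ge0$ and $P_{ij}<Q_{ij}^-$; $R_{ij}=1$ otherwise. For $i>M_h$, $R_{ij}=1$. Set $\alpha_{ij}=\min\{R_{ij},R_{ji}\}$. For $i\le M_h$, $j\in\mathcal N_i\setminus\{i\}$: $$\bar u_{ij}^s=\bar u_{ij}+\alpha_{ij}P_{ij}+\frac{b_i}{a_i^C},\qquad f_{ij}^s=2d_{ij}\Big[\frac{u_i-u_j}{2}-\alpha_{ij}P_{ij}\Big]+a_{ij}^R(u_i-u_j),$$ $\bar u_i^{\min}=\min_{j\in\mathcal N_i\setminus\{i\}}\bar u_{ij}^s$, $\bar u_i^{\max}=\max_{j\in\mathcal N_i\setminus\{i\}}\bar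 u_{ij}^s$. The limited fluxes are: $f_{ij}^{s,*}=0$ if $f_{ij}^s=0$; if $i,j\le M_h$, $$f_{ij}^{s,*}=\begin{cases}\min\{f_{ij}^s,\,2d_{ij}(\bar u_i^{\max}-\bar u_{ij}^s),\,2d_{ij}(\bar u_{ji}^s-\bar u_j^{\min})\}& f_{ij}^s>0,\\ \max\{f_{ij}^s,\,2d_{ij}(\bar u_i^{\min}-\bar u_{ij}^s),\,2d_{ij}(\bar u_{ji}^s-\bar u_j^{\max})\}& f_{ij}^s<0,\end{cases}$$ and if $i\le M_h<j$, $$f_{ij}^{s,*}=\begin{cases}\min\{f_{ij}^s,\,2d_{ij}(\bar u_i^{\max}-\bar u_{ij}^s)\}& f_{ij}^s>0,\\ \max\{f_{ij}^s,\,2d_{ij}(\bar u_i^{\min}-\bar u_{ij}^s)\}& f_{ij}^s<0.\end{cases}$$ Finally $\bar u_{ij}^{s,*}=\bar u_{ij}^s+f_{ij}^{s,*}/(2d_{ij})$. *)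

(* Defs.v *)
From HB Require Import structures.
From mathcomp Require Import all_boot all_order all_algebra.
From mathcomp Require Import all_classical all_reals all_analysis.

Set Implicit Arguments.
Unset Strict Implicit.
Unset Printing Implicit Defensive.

Import Order.TTheory GRing.Theory Num.Theory.
Import numFieldNormedType.Exports.

Local Open Scope classical_set_scope.
Local Open Scope ring_scope.

Section LebesgueStep.
Context (R : realType) (n : nat).
Local Notation RT := (measurableTypeR R).
Variables (m1 : {sigma_finite_measure set RT -> \bar R})
  (m : {sigma_finite_measure set (n.-tuple RT) -> \bar R}).

Definition tcons (p : RT * n.-tuple RT) : n.+1.-tuple RT :=
  [tuple of p.1 :: p.2].

Lemma measurable_tcons : measurable_fun [set: RT * n.-tuple RT] tcons.
Proof. exact: (measurable_cons measurable_fst measurable_snd). Qed.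

(* [m1 \x m] carried from R * R^n to R^(n+1) *)
Definition leb_step : set (n.+1.-tuple RT) -> \bar R :=
  pushforward (m1 \x m)%E tcons.

Let leb_step0 : leb_step set0 = 0%E.
Proof. by rewrite /leb_step /pushforward preimage_set0 measure0. Qed.

Let leb_step_ge0 A : (0 <= leb_step A)%E.
Proof. by rewrite /leb_step /pushforward; exact: measure_ge0. Qed.

Let leb_step_sigma_additive : semi_sigma_additive leb_step.
Proof.
move=> F mF tF mUF; rewrite /leb_step /pushforward preimage_bigcup.
have mpre (A : set (n.+1.-tuple RT)) :
    measurable A -> measurable (tcons @^-1` A).
  by move=> mA; rewrite -[X in measurable X]setTI; exact: measurable_tcons.
apply: measure_semi_sigma_additive.
- by move=> k; exact: mpre.
- apply/trivIsetP => /= i j _ _ ij; rewrite -preimage_setI.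
  by move/trivIsetP : tF => /(_ _ _ _ _ ij) ->//; rewrite preimage_set0.
- by rewrite -preimage_bigcup; exact: mpre.
Qed.

HB.instance Definition _ := isMeasure.Build _ _ _ leb_step
  leb_step0 leb_step_ge0 leb_step_sigma_additive.

(* the library's sigma-finiteness instance for m1 \x m2 is shadowed by its
   subprobability instance *)
Let prod_sigma_finite : sigma_finite setT (m1 \x m)%E.
Proof.
have /sigma_finiteP[F [TF ndF Foo]] := sigma_finiteT m1.
have /sigma_finiteP[G [TG ndG Goo]] := sigma_finiteT m.
exists (fun k => F k `*` G k).
  rewrite -setXTT TF TG predeqE => -[x y]; split.
    move=> [/= [i _ Fix] [k _ Gky]]; exists (maxn i k) => //; split.
    - by move: x Fix; exact/subsetPset/ndF/leq_maxl.
    - by move: y Gky; exact/subsetPset/ndG/leq_maxr.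
  by move=> [k _ []/= ? ?]; split; exists k.
move=> k; have [? ?] := Foo k; have [? ?] := Goo k.
split; first exact: measurableX.
by rewrite product_measure1E// lte_mul_pinfty// ge0_fin_numE.
Qed.

Let leb_step_sigma_finite : sigma_finite setT leb_step.
Proof.
have [F UF mF] := prod_sigma_finite.
pose unc (t : n.+1.-tuple RT) : RT * n.-tuple RT := (thead t, behead_tuple t).
have tK : cancel unc tcons.
  by move=> t; apply/val_inj; rewrite [RHS](congr1 val (tuple_eta t)).
have uK : cancel tcons unc.
  by move=> [a t]; rewrite /unc /tcons theadE; congr pair; exact/val_inj.
have munc : measurable_fun setT unc.
  apply: measurable_fun_pair; first exact: measurable_tnth.
  apply/measurable_fun_tnthP => i.
  rewrite (_ : _ \o _ = fun t : n.+1.-tuple RT => tnth t (lift ord0 i)).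
    exact: measurable_tnth.
  by apply/funext => t /=; rewrite tnth_behead; congr tnth; apply: val_inj;
     rewrite /= inordK // ltnS.
exists (fun k => unc @^-1` F k).
  by rewrite -preimage_bigcup -UF preimage_setT.
move=> k; split.
  by rewrite -[X in measurable X]setTI; apply: munc => //; exact: (mF k).1.
rewrite /leb_step /pushforward -comp_preimage.
rewrite (_ : unc \o tcons = id); last by apply/funext => p; exact: uK.
exact: (mF k).2.
Qed.

HB.instance Definition _ := Measure_isSigmaFinite.Build _ _ _ leb_step
  leb_step_sigma_finite.

End LebesgueStep.

Section Lebesgue.
Context (R : realType).
Local Notation RT := (measurableTypeR R).

(* d-fold product of the one-dimensional Lebesgue measure, on the product
   (i.e. Borel) sigma-algebra that the library puts on tuples *)
Fixpoint lebesgue_tuple (d : nat) :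
    {sigma_finite_measure set (d.-tuple RT) -> \bar R} :=
  if d is k.+1 return {sigma_finite_measure set (d.-tuple RT) -> \bar R}
  then leb_step lebesgue_measure (lebesgue_tuple k)
  else dirac ([tuple] : 0.-tuple RT).

Definition row_of_tuple (d : nat) (t : d.-tuple RT) : 'rV[R]_d :=
  \row_i (tnth t i : R).

Definition lebesgue_integral_rV (d : nat) (A : set 'rV[R]_d)
    (F : 'rV[R]_d -> R) : R :=
  \int[lebesgue_tuple d]_(t in @row_of_tuple d @^-1` A) F (row_of_tuple t).

End Lebesgue.

Section Geometry.
Context (R : realType) (d : nat).
Implicit Types (p q : 'rV[R]_d) (A : set 'rV[R]_d).

Definition dotr p q : R := \sum_(k < d) p 0 k * q 0 k.

(* the library norm `|p| on 'rV is the sup norm *)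
Definition enorm p : R := Num.sqrt (dotr p p).

Definition ediam A : R :=
  sup [set r | exists p q, [/\ A p, A q & r = enorm (p - q)]].

Definition topological_boundary A : set 'rV[R]_d := closure A `\` A°.

(* Near every boundary point, Omega is the strict epigraph, in some direction
   e, of a Lipschitz function of the component orthogonal to e. *)
Definition lipschitz_boundary (Omega : set 'rV[R]_d) : Prop :=
  forall p0, topological_boundary Omega p0 ->
  exists e : 'rV[R]_d, exists g : 'rV[R]_d -> R,
    [/\ enorm e = 1, lipschitz g &
        \forall p \near p0, Omega p <-> g (p - dotr p e *: e) < dotr p e].

Definition lipschitz_domain (Omega : set 'rV[R]_d) : Prop :=
  [/\ Omega !=set0, open Omega, connected Omega & lipschitz_boundary Omega].

(* Meaningful when F is affine on A and A is affinely spanning; then the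
   vector g below exists and is unique. *)
Definition grad_on A (F : 'rV[R]_d -> R) : 'rV[R]_d :=
  xget 0 [set g | forall p q, A p -> A q -> F p - F q = dotr g (p - q)].

Definition affine_on A (F : 'rV[R]_d -> R) : Prop :=
  exists g b, forall p, A p -> F p = dotr g p + b.

End Geometry.

(* Maximum and minimum of a family over a nonempty finite index set (the value
   0 for the empty set is a dummy). *)
Section MaxMin.
Context (R : realType) (I : finType).

Definition max_over (A : {set I}) (F : I -> R) : R :=
  if [pick k in A] is Some k then \big[Num.max/F k]_(j in A) F j else 0.

Definition min_over (A : {set I}) (F : I -> R) : R :=
  if [pick k in A] is Some k then \big[Num.min/F k]_(j in A) F j else 0.

End MaxMin.

(* Vertices are indexed from 0: the indices i < nfree are the non-Dirichlet
   nodes, nfree <= i < nvert the Dirichlet nodes. A mesh cell is encoded as the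
   set of the indices of its vertices. [ext_cell i j] is the cell K_j^i
   containing x_i and meeting the half line from x_i away from x_j. *)
Record wmc_data (R : realType) (d : nat) := WmcData {
  domain : set 'rV[R]_d;
  eps : R;
  vel : 'rV[R]_d -> 'rV[R]_d;
  reac : 'rV[R]_d -> R;
  src : 'rV[R]_d -> R;
  dirichlet : 'rV[R]_d -> R;
  nvert : nat;
  nfree : nat;
  vertex : 'I_nvert -> 'rV[R]_d;
  cells : {set {set 'I_nvert}};
  phi : 'I_nvert -> 'rV[R]_d -> R;
  delta : R;
  ext_cell : 'I_nvert -> 'I_nvert -> {set 'I_nvert} }.

Arguments vertex {R d} S i : rename.
Arguments phi {R d} S i p : rename.
Arguments ext_cell {R d} S i j : rename.

Section Scheme.
Context (R : realType) (d : nat) (S : wmc_data R d).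
Local Notation N := (nvert S).
Implicit Types (i j : 'I_N) (K : {set 'I_N}) (p : 'rV[R]_d) (u : 'cV[R]_N).

Definition simplex K : set 'rV[R]_d :=
  [set p | exists w : 'I_N -> R,
     [/\ forall i, i \in K -> 0 <= w i, \sum_(i in K) w i = 1 &
         p = \sum_(i in K) w i *: vertex S i]].

Definition affinely_independent K : Prop :=
  forall w : 'I_N -> R,
    \sum_(i in K) w i = 0 -> \sum_(i in K) w i *: vertex S i = 0 ->
    forall i, i \in K -> w i = 0.

Record conforming_simplex_mesh : Prop := ConformingSimplexMesh {
  mesh_card : forall K, K \in cells S -> #|K| = d.+1;
  mesh_nondegenerate : forall K, K \in cells S -> affinely_independent K;
  mesh_conforming : forall K K', K \in cells S -> K' \in cells S ->
    simplex K `&` simplex K' = simplex (K :&: K');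
  mesh_cover : \bigcup_(K in [set` cells S]) simplex K = closure (domain S);
  mesh_vertices : forall i, exists2 K, K \in cells S & i \in K }.

Definition mesh_size : R :=
  \big[Num.max/0]_(K in cells S) ediam (simplex K).

Record lagrange_basis : Prop := LagrangeBasis {
  lagrange_continuous :
    forall j, {within closure (domain S), continuous (phi S j)};
  lagrange_P1 : forall j K, K \in cells S -> affine_on (simplex K) (phi S j);
  lagrange_nodal : forall i j, phi S j (vertex S i) = (i == j)%:R }.

Definition dirichlet_numbering : Prop :=
  (nfree S <= N)%N /\
  forall i, (nfree S <= i)%N <-> topological_boundary (domain S) (vertex S i).

Definition fe_fun u p : R := \sum_(j < N) u j 0 * phi S j p.

(* The piecewise constant gradient of a continuous, piecewise linear function.
   On the interfaces between cells, a Lebesgue-null set, it takes the value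
   from one of the adjacent cells. *)
Definition broken_grad (F : 'rV[R]_d -> R) p : 'rV[R]_d :=
  if [pick K in cells S | `[< simplex K p >]] is Some K
  then grad_on (simplex K) F else 0.

Definition nbr i : {set 'I_N} :=
  [set j | [exists K in cells S, (i \in K) && (j \in K)]].

Definition nbr' i : {set 'I_N} := nbr i :\ i.

(* Like Rintegral, total: 0 where the library integral is infinite. *)
Definition int_domain (F : 'rV[R]_d -> R) : R :=
  lebesgue_integral_rV (domain S) F.

Definition aD i j : R := eps S *
  int_domain (fun p => dotr (broken_grad (phi S i) p) (broken_grad (phi S j) p)).

Definition aC i j : R :=
  int_domain (fun p => phi S i p * dotr (vel S p) (broken_grad (phi S j) p)).

Definition aR i j : R :=
  int_domain (fun p => reac S p * phi S i p * phi S j p).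

Definition load i : R := int_domain (fun p => phi S i p * src S p).

Definition aRsum i : R := \sum_(j in nbr i) aR i j.

Definition visc_off i j : R :=
  if j \in nbr' i then
    Num.max `|aC i j| (Num.max (delta S * mesh_size ^+ d.-1) `|aC j i|)
  else 0.

Definition visc i j : R :=
  if i == j then - \sum_(k in nbr' i) visc_off i k else visc_off i j.

Definition aCsum i : R := \sum_(j in nbr' i) 2 * visc i j.

Definition offdiag_diffusion_nonpos : Prop :=
  forall i j, i != j -> aD i j <= 0.

Definition velocity_nonvanishing : Prop :=
  forall i j, j \in nbr' i ->
    0 < enorm (vel S (vertex S i)) + enorm (vel S (vertex S j)).

Definition ext_cell_spec : Prop :=
  forall i j, (i < nfree S)%N -> j \in nbr' i ->
    [/\ ext_cell S i j \in cells S, i \in ext_cell S i j &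
        exists2 t, 0 < t & simplex (ext_cell S i j)
          (vertex S i + t *: (vertex S i - vertex S j))].

Definition ubar u i j : R :=
  (u j 0 + u i 0) / 2 - aC i j * (u j 0 - u i 0) / (2 * visc i j).

Definition s_node u i : R := src S (vertex S i) - reac S (vertex S i) * u i 0.

Definition P_wb u i j : R :=
  let vi := vel S (vertex S i) in
  let vj := vel S (vertex S j) in
  1 / 2 * ((s_node u i + s_node u j) / 2) *
  (dotr (vertex S i - vertex S j) (vi + vj) /
   (2 * Num.max (enorm vi) (enorm vj) ^+ 2)).

Definition u_ext u i j : R :=
  u i 0 + dotr (grad_on (simplex (ext_cell S i j)) (fe_fun u))
               (vertex S i - vertex S j).

Definition Qp u i j : R :=
  Num.max ((u_ext u i j - u i 0) / 2)
          (Num.max (u i 0) (u j 0) - ubar u i j - load i / aCsum i).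

Definition Qm u i j : R :=
  Num.min ((u_ext u i j - u i 0) / 2)
          (Num.min (u i 0) (u j 0) - ubar u i j - load i / aCsum i).

Definition Rlim u i j : R :=
  if (i < nfree S)%N then
    if (load i <= 0) && (Qp u i j < P_wb u i j) then Qp u i j / P_wb u i j
    else if (0 <= load i) && (P_wb u i j < Qm u i j) then Qm u i j / P_wb u i j
    else 1
  else 1.

Definition alpha u i j : R := Num.min (Rlim u i j) (Rlim u j i).

Definition ubar_s u i j : R :=
  ubar u i j + alpha u i j * P_wb u i j + load i / aCsum i.

Definition f_s u i j : R :=
  2 * visc i j * ((u i 0 - u j 0) / 2 - alpha u i j * P_wb u i j)
  + aR i j * (u i 0 - u j 0).

Definition ubar_min u i : R := min_over (nbr' i) (ubar_s u i).

Definition ubar_max u i : R := max_over (nbr' i) (ubar_s u i).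

(* Only meaningful, and only used, for i < nfree. *)
Definition f_s_star u i j : R :=
  if f_s u i j == 0 then 0
  else if 0 < f_s u i j then
    let m := Num.min (f_s u i j)
                     (2 * visc i j * (ubar_max u i - ubar_s u i j)) in
    if (j < nfree S)%N
    then Num.min m (2 * visc i j * (ubar_s u j i - ubar_min u j)) else m
  else
    let m := Num.max (f_s u i j)
                     (2 * visc i j * (ubar_min u i - ubar_s u i j)) in
    if (j < nfree S)%N
    then Num.max m (2 * visc i j * (ubar_s u j i - ubar_max u j)) else m.

Definition ubar_s_star u i j : R :=
  ubar_s u i j + f_s_star u i j / (2 * visc i j).

Definition wmc_solution u : Prop :=
  (forall i, (i < nfree S)%N ->
    aRsum i * u i 0
    - \sum_(j in nbr' i) (2 * visc i j * (ubar_s_star u i j - u i 0)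
                          - aD i j * (u j 0 - u i 0)) = 0) /\
  (forall i, (nfree S <= i)%N -> u i 0 = dirichlet S (vertex S i)).

End Scheme.

(* Main.v *)
Require Import Defs.
From mathcomp Require Import all_boot all_order all_algebra.
From mathcomp Require Import all_classical all_reals all_analysis.
From mathcomp Require Import measurable_realfun.
From mathcomp Require Import lra ring.

Set Implicit Arguments.
Unset Strict Implicit.
Unset Printing Implicit Defensive.

Import Order.TTheory GRing.Theory Num.Theory.
Import numFieldNormedType.Exports.

Local Open Scope classical_set_scope.
Local Open Scope ring_scope.

(* Suppose b_i <= 0 and u_i > u_j for every neighbour j (b_i >= 0 is dual).
   Writing the scheme as
     a_i^R u_i = sum_j [2 d_ij (ubar_ij^{s*} - u_i) + a_ij^D (u_i - u_j)],
   the first part is nonpositive: the correction factors lie in [0, 1] and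
   force ubar_ij^s <= u_i, since u_j^i <= u_i at a local maximum of u_h, and the
   flux limiter keeps ubar_ij^{s*} below max_j ubar_ij^s. The second part is
   strictly negative: the row sums of the stiffness matrix vanish and
   a_ii^D > 0, so some a_ij^D is negative. Hence a_i^R u_i < 0, which is absurd
   if a_i^R = 0, and also if u_i >= 0 because a_i^R >= 0.
   The facts on a^D require actual integration: broken gradients depend only on
   the cell of the point, a finite-valued measurable function, and every
   cell contains a ball on which that function is constant. *)

(** * Lebesgue measure on tuples *)

Section LebesgueTuple.
Context (R : realType).
Local Notation RT := (measurableTypeR R).

Lemma measurable_affine_tuple (d : nat) (a : 'rV[R]_d) (b : R) :
  measurable_fun [set: d.-tuple RT]
    (fun t => dotr a (row_of_tuple t) + b : R).
Proof.
apply: measurable_funD => //.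
rewrite (_ : (fun t => dotr a (row_of_tuple t)) =
   fun t => \sum_(k <- index_enum 'I_d) (a 0 k * (tnth t k : R))); last first.
  by apply/funext => t; apply: eq_bigr => k _; rewrite mxE.
apply: measurable_sum => k; apply: measurable_funM => //.
exact: measurable_tnth.
Qed.

Lemma measurable_tuple_box (d : nat) (A : 'I_d -> set RT) :
  (forall k, measurable (A k)) ->
  measurable [set t : d.-tuple RT | forall k, A k (tnth t k)].
Proof.
move=> mA.
rewrite (_ : [set t | _] =
  \bigcap_(k in [set: 'I_d]) (fun t : d.-tuple RT => tnth t k) @^-1` A k).
  apply: fin_bigcap_measurable => // k _.
  by rewrite -[X in measurable X]setTI; exact: measurable_tnth.
by apply/seteqP; split => t /= h k; [move=> _|]; exact: h.
Qed.

(** Induction on [d]: [tcons] pulls a box back to the product of its first side and the box of the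
    other sides; for [d = 0] the Dirac mass is the empty product. *)
Lemma lebesgue_tuple_box (d : nat) (A : 'I_d -> set RT) :
  (forall k, measurable (A k)) ->
  (lebesgue_tuple R d [set t | forall k, A k (tnth t k)] =
   \prod_(k < d) (lebesgue_measure (A k) : \bar R))%E.
Proof.
elim: d A => [|d ih] A mA.
  rewrite big_ord0 /= diracE mem_set //=; by case.
rewrite big_ord_recl -ih; last by move=> k; exact: mA.
rewrite /= /leb_step /pushforward -product_measure1E //; last first.
  by apply: (measurable_tuple_box (A := fun k => A (lift ord0 k))) => k; exact: mA.
congr (_ _); apply/seteqP; split => -[x t] /=.
  move=> h; split; first exact: (h ord0).
  by move=> k; have := h (lift ord0 k); rewrite tnthS.
by move=> [h0 h] k; case: (unliftP ord0 k) => [j ->|->] //; rewrite tnthS.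
Qed.

(** Balls of ['rV] are taken in the sup norm, so they are cubes, to which the box formula
    applies. *)
Lemma row_of_tuple_ball (d : nat) (c : 'rV[R]_d) (r : R) :
  0 < r ->
  @row_of_tuple R d @^-1` ball c r =
  [set t | forall k, (ball (c 0 k) r : set RT) (tnth t k)].
Proof.
move=> r0; apply/seteqP; split => t /=.
  by move=> [_ h] k; have := h 0 k; rewrite mxE.
move=> h; split => // i k; rewrite (ord1 i) mxE; exact: h.
Qed.

Lemma measurable_row_of_tuple_ball (d : nat) (c : 'rV[R]_d) (r : R) : 0 < r ->
  measurable (@row_of_tuple R d @^-1` ball c r).
Proof.
move=> r0; rewrite row_of_tuple_ball //.
by apply: (measurable_tuple_box (A := fun k => ball (c 0 k) r)) => k;
  exact: measurable_ball.
Qed.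

Lemma lebesgue_tuple_ball (d : nat) (c : 'rV[R]_d) (r : R) : 0 < r ->
  lebesgue_tuple R d (@row_of_tuple R d @^-1` ball c r) = ((r *+ 2) ^+ d)%:E.
Proof.
move=> r0; rewrite row_of_tuple_ball //; etransitivity.
  apply: (lebesgue_tuple_box (A := fun k => ball (c 0 k) r)) => k.
  exact: measurable_ball.
under eq_bigr do rewrite lebesgue_measure_ball ?ltW//.
by rewrite prodEFin prodr_const card_ord.
Qed.

(** The sigma-algebra on tuples comes from the coordinates, so the open set is exhausted by
    countably many cubes with rational centres and radii 1/(n+1). *)
Lemma measurable_row_of_tuple_open (d : nat) (U : set 'rV[R]_d) : open U ->
  measurable (@row_of_tuple R d @^-1` U).
Proof.
move=> oU.
pose c (x : 'rV[rat]_d * nat) : 'rV[R]_d := map_mx ratr x.1.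
pose e (x : 'rV[rat]_d * nat) : R := x.2.+1%:R^-1.
have near_left (z y r : R) : y - r < z -> z < y -> 0 < r -> `|z - y| < r.
  by move=> *; rewrite ltr_norml; apply/andP; split; lra.
have e0 x : 0 < e x by rewrite invr_gt0.
pose F x : set (d.-tuple RT) :=
  if `[< ball (c x) (e x) `<=` U >]
  then @row_of_tuple R d @^-1` ball (c x) (e x) else set0.
rewrite (_ : _ @^-1` _ = \bigcup_x F x); last first.
  apply/seteqP; split => [t Ut|t [x _]]; last first.
    by rewrite /F; case: asboolP => // sub /sub.
  move: oU; rewrite openE => /(_ _ Ut) /nbhs_ballP[r /= r0 rU].
  (* Half of [r], because the triangle inequality below adds two distances smaller than 1/(n+1). *)
  have [n nr] : exists n, n.+1%:R^-1 < r / 2.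
    have := near_infty_natSinv_lt (PosNum (divr_gt0 r0 (ltr0n R 2))).
    by move=> [n _ /(_ n (leqnn n))] /=; exists n.
  have n0 : 0 < n.+1%:R^-1 :> R by rewrite invr_gt0.
  have hq k : {q : rat | (tnth t k : R) - n.+1%:R^-1 < ratr q < tnth t k}.
    apply: cid; have : (tnth t k : R) - n.+1%:R^-1 < tnth t k by rewrite ltrBlDr ltrDl.
    by move=> /rat_in_itvoo[q]; rewrite in_itv /= => qq; exists q.
  pose q := \row_k sval (hq k).
  have qt : ball (c (q, n)) (e (q, n)) (row_of_tuple t).
    split => // i k; rewrite (ord1 i) !mxE.
    have /andP[h1 h2] := svalP (hq k).
    rewrite -ball_normE /ball_ /=; exact: (near_left _ _ _ h1 h2 n0).
  exists (q, n) => //; rewrite /F; case: asboolP => //; case.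
  move=> p pq; apply: rU; apply: (@le_ball _ _ _ (e (q, n) + e (q, n))).
    by rewrite [leRHS]splitr; apply: lerD; exact: ltW nr.
  apply: ball_triangle pq; exact: ball_sym.
apply: countable_bigcupT_measurable => // x; rewrite /F.
by case: asboolP => // _; exact: measurable_row_of_tuple_ball.
Qed.

End LebesgueTuple.

(** * Barycentric coordinates on a nondegenerate simplex *)

Section DotProduct.
Context (R : realType) (d : nat).
Implicit Types p q r : 'rV[R]_d.

Lemma dotrDl p q r : dotr (p + q) r = dotr p r + dotr q r.
Proof. by rewrite -big_split; apply: eq_bigr => k _; rewrite mxE mulrDl. Qed.

Lemma dotrC p q : dotr p q = dotr q p.
Proof. by apply: eq_bigr => k _; rewrite mulrC. Qed.

Lemma dotrDr p q r : dotr r (p + q) = dotr r p + dotr r q.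
Proof. by rewrite !(dotrC r) dotrDl. Qed.

Lemma dotrZl (a : R) p q : dotr (a *: p) q = a * dotr p q.
Proof. by rewrite mulr_sumr; apply: eq_bigr => k _; rewrite mxE mulrA. Qed.

Lemma dotrZr (a : R) p q : dotr p (a *: q) = a * dotr p q.
Proof. by rewrite dotrC dotrZl dotrC. Qed.

Lemma dotrBr p q r : dotr r (p - q) = dotr r p - dotr r q.
Proof. by rewrite dotrDr -scaleN1r dotrZr mulN1r. Qed.

Lemma dotr0l p : dotr 0 p = 0.
Proof. by rewrite -(scale0r 0) dotrZl mul0r. Qed.

Lemma dotr0r p : dotr p 0 = 0.
Proof. by rewrite dotrC dotr0l. Qed.

Lemma dotr_suml (I : Type) (s : seq I) (P : pred I) (F : I -> 'rV[R]_d) p :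
  dotr (\sum_(i <- s | P i) F i) p = \sum_(i <- s | P i) dotr (F i) p.
Proof.
by elim/big_rec2: _ => [|i x y _ <-]; rewrite ?dotr0l // dotrDl.
Qed.

Lemma dotr_sumr (I : Type) (s : seq I) (P : pred I) (F : I -> 'rV[R]_d) p :
  dotr p (\sum_(i <- s | P i) F i) = \sum_(i <- s | P i) dotr p (F i).
Proof. by rewrite dotrC dotr_suml; apply: eq_bigr => i _; rewrite dotrC. Qed.

Lemma dotr_ge0 p : 0 <= dotr p p.
Proof. by apply: sumr_ge0 => k _; rewrite -expr2 sqr_ge0. Qed.

Lemma dotr_eq0 p : dotr p p = 0 -> p = 0.
Proof.
move=> p0; apply/rowP => k; rewrite mxE; apply/eqP; move/eqP: p0.
rewrite psumr_eq0 => [/allP/(_ k (mem_index_enum k))|j _]; last first.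
  by rewrite -expr2 sqr_ge0.
by rewrite /= mulf_eq0 orbb.
Qed.

Lemma dotr_continuous (g : 'rV[R]_d) : continuous (dotr g).
Proof.
apply: (@continuous_big R _ +%R 0 xpredT (@add_continuous R) _
  (index_enum 'I_d) (fun k q => g 0 k * q 0 k)) => k _ p.
by apply: continuousM; [exact: cst_continuous|exact: coord_continuous].
Qed.

End DotProduct.

Section Simplex.
Context (R : realType) (d : nat) (S : wmc_data R d).
Local Notation N := (nvert S).
Context (K : {set 'I_N}).
Context (K_card : #|K| = d.+1) (K_indep : affinely_independent K).

Lemma affinely_independent_weights (w w' : 'I_N -> R) :
  \sum_(i in K) w i = \sum_(i in K) w' i ->
  \sum_(i in K) w i *: vertex S i = \sum_(i in K) w' i *: vertex S i ->
  forall i, i \in K -> w i = w' i.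
Proof.
move=> e1 e2 i iK; apply/eqP; rewrite -subr_eq0; apply/eqP.
apply: (K_indep (w := fun i => w i - w' i)) iK.
  by rewrite big_split /= sumrN e1 subrr.
under eq_bigr do rewrite scalerBl.
by rewrite big_split /= sumrN e2 subrr.
Qed.

Lemma simplex_vertex i : i \in K -> simplex K (vertex S i).
Proof.
move=> iK; exists (fun j => (j == i)%:R); split.
- by move=> j _; rewrite ler0n.
- by rewrite (bigD1 i) //= eqxx big1 ?addr0 // => j /andP[_ /negPf ->].
- rewrite (bigD1 i) //= eqxx scale1r big1 ?addr0 // => j /andP[_ /negPf ->].
  by rewrite scale0r.
Qed.

(** The matrix [A] with rows (1, x_i), i in [K], is square of order d+1, and affine independence
    makes its rows free. Solving (1, p) = v A gives weights v that are affine in p. *)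
Lemma barycentric_coordinates : exists g : 'I_N -> 'rV[R]_d, exists b : 'I_N -> R,
  forall p, \sum_(i in K) (dotr (g i) p + b i) = 1 /\
            \sum_(i in K) (dotr (g i) p + b i) *: vertex S i = p.
Proof.
have [i0 i0K] : exists i, i \in K by apply/card_gt0P; rewrite K_card.
pose A : 'M[R]_(#|K|, 1 + d) :=
  \matrix_k row_mx (1%:M : 'M[R]_1) (vertex S (enum_val k)).
(* The product [v *m A] records the total weight and the weighted sum of the vertices. *)
have rowA (v : 'rV[R]_#|K|) : v *m A =
    row_mx (\sum_(i in K) v 0 (enum_rank_in i0K i))%:M
           (\sum_(i in K) v 0 (enum_rank_in i0K i) *: vertex S i).
  rewrite -[v *m A]hsubmxK; congr row_mx; apply/rowP => l.
    rewrite !mxE (ord1 l) eqxx mulr1n [RHS]big_enum_val; apply: eq_bigr => k _.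
    by rewrite !mxE enum_valK_in (unsplitK (inl _)) !mxE eqxx mulr1.
  rewrite !mxE summxE [RHS]big_enum_val; apply: eq_bigr => k _.
  by rewrite !mxE enum_valK_in (unsplitK (inr _)).
have fullA : row_full A.
  rewrite /row_full -[X in _ == X]K_card -/(row_free A).
  apply: inj_row_free => v; rewrite rowA -[RHS]row_mx0 => /eq_row_mx[v1 v2].
  have {}v1 : \sum_(i in K) v 0 (enum_rank_in i0K i) = 0.
    by move/matrixP : v1 => /(_ 0 0); rewrite !mxE eqxx mulr1n.
  apply/rowP => k; rewrite mxE -(K_indep v1 v2 (enum_valP k)).
  by rewrite enum_valK_in.
pose B := pinvmx A.
exists (fun i => \row_l B (rshift 1 l) (enum_rank_in i0K i)).
exists (fun i => B (lshift d 0) (enum_rank_in i0K i)) => p.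
have := mulmxKpV (submx_full (row_mx 1%:M p) fullA); rewrite rowA => /eq_row_mx[].
have coord i : (row_mx 1%:M p *m B) 0 (enum_rank_in i0K i) =
    dotr (\row_l B (rshift 1 l) (enum_rank_in i0K i)) p +
    B (lshift d 0) (enum_rank_in i0K i).
  rewrite mxE big_split_ord big_ord1 /= addrC row_mxEl mxE eqxx mul1r.
  by congr (_ + _); apply: eq_bigr => l _; rewrite row_mxEr mxE mulrC.
move=> /matrixP/(_ 0 0) e1 e2; split.
  by move: e1; rewrite !mxE eqxx !mulr1n => <-; apply: eq_bigr => i _; rewrite -coord.
by rewrite -[RHS]e2; apply: eq_bigr => i _; rewrite -coord.
Qed.

(** Weights are unique, so those witnessing membership are the barycentric coordinates. *)
Lemma simplex_barycentric (g : 'I_N -> 'rV[R]_d) (b : 'I_N -> R) :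
  (forall p, \sum_(i in K) (dotr (g i) p + b i) = 1 /\
             \sum_(i in K) (dotr (g i) p + b i) *: vertex S i = p) ->
  simplex K = [set p | forall i, i \in K -> 0 <= dotr (g i) p + b i].
Proof.
move=> gb; apply/seteqP; split => p /=; last first.
  by move=> h; exists (fun i => dotr (g i) p + b i); have [-> ->] := gb p.
move=> [w [w0 w1 wp]] i iK; have [b1 bp] := gb p.
have -> : dotr (g i) p + b i = w i.
  apply: (affinely_independent_weights
            (w := fun i => dotr (g i) p + b i)) iK => //.
    by rewrite b1.
  by rewrite bp.
exact: w0.
Qed.

Lemma measurable_simplex :
  measurable (@row_of_tuple R d @^-1` simplex K).
Proof.
have [g [b gb]] := barycentric_coordinates.
rewrite (simplex_barycentric gb).
rewrite (_ : _ @^-1` _ = \bigcap_(i in [set` K])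
    (fun t => dotr (g i) (row_of_tuple t) + b i) @^-1` `[0, +oo[%classic).
  apply: fin_bigcap_measurable => // i _.
  rewrite -[X in measurable X]setTI; apply: measurable_affine_tuple => //.
by apply/seteqP; split => t /= h i iK; have := h i iK; rewrite /= in_itv /= andbT.
Qed.

Definition barycenter : 'rV[R]_d := \sum_(i in K) d.+1%:R^-1 *: vertex S i.

(** [U] is the set where all barycentric coordinates are positive; at the barycenter they all equal
    1/(d+1). *)
Lemma simplex_interior : exists U : set 'rV[R]_d,
  [/\ open U, U barycenter & forall p, U p -> exists w : 'I_N -> R,
    [/\ forall i, i \in K -> 0 < w i, \sum_(i in K) w i = 1 &
        p = \sum_(i in K) w i *: vertex S i]].
Proof.
have [g [b gb]] := barycentric_coordinates.
exists [set p | forall i, i \in K -> 0 < dotr (g i) p + b i]; split.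
- rewrite openE => p /= hp.
  apply: (@filter_forall _ _
    (fun i q => i \in K -> 0 < dotr (g i) q + b i) (nbhs p)) => i.
  case: (boolP (i \in K)) => [iK|_]; last by apply: nearW.
  have gbi : dotr (g i) q + b i @[q --> p] --> dotr (g i) p + b i.
    exact: (cvgD (@dotr_continuous _ _ (g i) p) (cvg_cst (b i))).
  by apply: filterS (cvgr_gt _ gbi _ (hp i iK)) => q h _.
- move=> i iK; have [b1 bp] := gb barycenter.
  have -> : dotr (g i) barycenter + b i = d.+1%:R^-1.
    apply: (affinely_independent_weights (w' := fun=> d.+1%:R^-1)
              (w := fun i => dotr (g i) barycenter + b i)) iK => //.
    by rewrite b1 sumr_const K_card -[RHS]mulr_natr mulVf.
  by rewrite invr_gt0.
- move=> p hp; exists (fun i => dotr (g i) p + b i).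
  by have [-> ->] := gb p; split.
Qed.

(** Every point is an affine combination of the vertices, so [dotr g] is constant on the whole
    space; comparing its values at [g] and at 0 gives [dotr g g = 0]. *)
Lemma simplex_spanning (g : 'rV[R]_d) :
  (forall p q, simplex K p -> simplex K q -> dotr g (p - q) = 0) -> g = 0.
Proof.
move=> g0; have [h [b hb]] := barycentric_coordinates.
have [i0 i0K] : exists i, i \in K by apply/card_gt0P; rewrite K_card.
have gE p : dotr g p = dotr g (vertex S i0).
  have [b1 <-] := hb p; rewrite dotr_sumr -[RHS]mul1r -b1 mulr_suml.
  apply: eq_bigr => i iK; rewrite dotrZr; congr (_ * _).
  by apply/eqP; rewrite -subr_eq0 -dotrBr g0 //; exact: simplex_vertex.
by apply: dotr_eq0; rewrite gE -(gE 0) dotr0r.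
Qed.

(** An affine representation supplies a witness, so the [xget] in [grad_on] does not fall back on
    its default. *)
Lemma affine_on_grad (F : 'rV[R]_d -> R) : affine_on (simplex K) F ->
  forall p q, simplex K p -> simplex K q ->
    F p - F q = dotr (grad_on (simplex K) F) (p - q).
Proof.
move=> [g [b gF]]; apply: (@xgetPex _ 0 [set g | forall p q, simplex K p ->
  simplex K q -> F p - F q = dotr g (p - q)]).
by exists g => p q pK qK; rewrite !gF // dotrBr; lra.
Qed.

Lemma affine_on_weights (F : 'rV[R]_d -> R) (w : 'I_N -> R) :
  affine_on (simplex K) F ->
  (forall i, i \in K -> 0 <= w i) -> \sum_(i in K) w i = 1 ->
  F (\sum_(i in K) w i *: vertex S i) = \sum_(i in K) w i * F (vertex S i).
Proof.
move=> [g [b gF]] w0 w1; rewrite gF; last by exists w.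
rewrite dotr_sumr -[b in LHS]mul1r -w1 mulr_suml -big_split /=.
apply: eq_bigr => i iK; rewrite dotrZr gF; first by rewrite mulrDr.
exact: simplex_vertex.
Qed.

End Simplex.

(** * Integration of functions of the mesh cell *)

Section Mesh.
Context (R : realType) (d : nat) (S : wmc_data R d).
Context (mesh_S : conforming_simplex_mesh S).
Local Notation N := (nvert S).
Local Notation RT := (measurableTypeR R).

(** The choice of cell made inside [broken_grad], isolated because it does not depend on the
    function: all broken gradients factor through this finite-valued map. *)
Definition cell_at (p : 'rV[R]_d) : option {set 'I_N} :=
  [pick K in cells S | `[< simplex K p >]].

Lemma broken_gradE F p :
  broken_grad S F p = oapp (fun K => grad_on (simplex K) F) 0 (cell_at p).
Proof. by rewrite /broken_grad /cell_at; case: pickP. Qed.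

Lemma cell_at_in p K : cell_at p = Some K -> K \in cells S.
Proof. by rewrite /cell_at; case: pickP => // K' /andP[K'S _] [<-]. Qed.

(** If the point also lay in a cell [K'], conformity would put it in the common face; by uniqueness
    of weights every vertex of [K] then belongs to [K'], and the cardinalities agree. *)
Lemma cell_at_interior K (w : 'I_N -> R) : K \in cells S ->
  (forall i, i \in K -> 0 < w i) -> \sum_(i in K) w i = 1 ->
  cell_at (\sum_(i in K) w i *: vertex S i) = Some K.
Proof.
move=> KS w0 w1; set p := \sum_(i in K) _.
have pK : simplex K p by exists w; split => // i /w0 /ltW.
rewrite /cell_at; case: pickP => [K' /andP[K'S /asboolP pK']|/(_ K)]; last first.
  by rewrite KS /=; case: asboolP.
have : simplex (K :&: K') p by rewrite -(mesh_conforming mesh_S KS K'S).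
move=> [v [v0 v1 pv]]; congr Some; apply/esym/eqP.
rewrite eqEcard !(mesh_card mesh_S) // leqnn andbT.
apply/fintype.subsetP => i iK; apply/negPn/negP => iK'.
(* Extension by zero turns weights on the common face into weights on [K]. *)
have restr (V : nmodType) (F : 'I_N -> V) :
    \sum_(i in K) (if i \in K' then F i else 0) = \sum_(i in K :&: K') F i.
  by rewrite -big_mkcondr; apply: eq_bigl => j; rewrite inE.
have := w0 i iK.
rewrite (affinely_independent_weights (mesh_nondegenerate mesh_S KS)
  (w' := fun i => if i \in K' then v i else 0) _ _ iK) ?(negPf iK') ?ltxx //.
  by rewrite restr v1.
rewrite -/p pv -restr; apply: eq_bigr => j _.
by case: ifP => // _; rewrite scale0r.
Qed.

(** The value depends only on the set [B t] of cells containing the point. This set takes finitely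
    many values, with measurable level sets, so the function is a finite combination of
    indicators. *)
Lemma measurable_cell_at (H : option {set 'I_N} -> R) :
  measurable_fun [set: d.-tuple RT] (fun t => H (cell_at (row_of_tuple t))).
Proof.
pose B t := [set K in cells S | `[< simplex K (@row_of_tuple R d t) >]]%SET.
have cellB t : cell_at (row_of_tuple t) = [pick K in B t].
  by apply: eq_pick => K; rewrite !inE.
have mB B0 : measurable [set t | B t = B0].
  rewrite (_ : [set t | _] = \bigcap_(K in [set: {set 'I_N}])
      [set t | (K \in B t) = (K \in B0)]); last first.
    apply/seteqP; split => t /= h; first by move=> K _; rewrite /= h.
    by apply/setP => K; exact: h.
  apply: fin_bigcap_measurable => // K _.
  case: (boolP (K \in cells S)) => KS; last first.
    case: (boolP (K \in B0)) => _.
      rewrite (_ : [set t | _] = set0) //.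
      by apply/seteqP; split => t //=; rewrite inE (negPf KS).
    rewrite (_ : [set t | _] = setT) //.
    by apply/seteqP; split => t //= _; rewrite inE (negPf KS).
  have mK := measurable_simplex (mesh_card mesh_S KS) (mesh_nondegenerate mesh_S KS).
  case: (boolP (K \in B0)) => _.
    rewrite (_ : [set t | _] = @row_of_tuple R d @^-1` simplex K) //.
    apply/seteqP; split => t /=; rewrite inE KS /=; first by move/asboolP.
    by move=> ?; exact/asboolP.
  rewrite (_ : [set t | _] = ~` (@row_of_tuple R d @^-1` simplex K)).
    exact: measurableC.
  apply/seteqP; split => t /=; rewrite inE KS /=; first by move/asboolP.
  by move=> ?; exact/asboolP.
rewrite (_ : (fun t => _) = fun t : d.-tuple RT =>
    \sum_(B0 : {set {set 'I_N}}) H [pick K in B0] * \1_[set t | B t = B0] t).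
  apply: measurable_sum => B0; exact: measurable_funM.
apply/funext => t; rewrite (bigD1 (B t)) //= indicE mem_set // mulr1 big1 ?addr0 //.
  by rewrite cellB.
by move=> B0 /eqP B0t; rewrite indicE memNset ?mulr0 // => /esym.
Qed.

Lemma simplex_bounded : exists2 r : R, 0 < r & forall (K : {set 'I_N}) p,
  simplex K p -> ball (0 : 'rV[R]_d) r p.
Proof.
(* [M] bounds every coordinate of a convex combination of vertices; adding 1 makes the radius
   positive and the bound strict. *)
pose M : R := \sum_(i < N) \sum_(k < d) `|vertex S i 0 k|.
have M0 : 0 <= M by apply: sumr_ge0 => i _; apply: sumr_ge0.
have M1 : 0 < M + 1 by rewrite ltr_wpDl.
exists (M + 1) => // K p [w [w0 w1 ->]]; split => // i k.
rewrite (ord1 i) !mxE /ball /= sub0r normrN summxE.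
apply: (@le_lt_trans _ _ M); last by rewrite ltrDl.
apply: le_trans (ler_norm_sum _ _ _) _.
rewrite big_mkcond /=; apply: ler_sum => j _; case: ifP => jK; last first.
  exact: sumr_ge0.
apply: (@le_trans _ _ `|vertex S j 0 k|); last first.
  by rewrite (bigD1 k) //= lerDl; apply: sumr_ge0.
rewrite mxE normrM ler_piMl // ger0_norm ?w0 //.
by rewrite -w1 (bigD1 j) //= lerDl; apply: sumr_ge0 => l /andP[/w0].
Qed.

Lemma closure_domain_cell p : closure (domain S) p ->
  exists2 K, K \in cells S & simplex K p.
Proof. by rewrite -(mesh_cover mesh_S) => -[K KS pK]; exists K. Qed.

(** The function has finitely many values, hence is bounded, and the domain is covered by cells,
    hence lies in a ball of finite measure. *)
Lemma integrable_cell_at (H : option {set 'I_N} -> R) :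
  open (domain S) ->
  (lebesgue_tuple R d).-integrable (@row_of_tuple R d @^-1` domain S)
    (EFin \o (fun t => H (cell_at (row_of_tuple t)))).
Proof.
move=> oS; have mD := measurable_row_of_tuple_open oS.
apply: measurable_bounded_integrable => //.
- have [r r0 hr] := simplex_bounded.
  apply: (@le_lt_trans _ _
      (lebesgue_tuple R d (@row_of_tuple R d @^-1` ball 0 r))).
    apply: le_measure; rewrite ?inE //; first exact: measurable_row_of_tuple_ball.
    by move=> t /subset_closure /closure_domain_cell[K KS]; exact: hr.
  by rewrite lebesgue_tuple_ball // ltry.
- exact: measurable_funTS (measurable_cell_at H).
- exists (\sum_o `|H o|); split; first exact: num_real.
  move=> M hM t _ /=; apply: ltW; apply: le_lt_trans hM.
  by rewrite (bigD1 (cell_at (row_of_tuple t))) //= lerDl; apply: sumr_ge0.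
Qed.

Lemma int_domain_sum (I : Type) (s : seq I) (H : I -> option {set 'I_N} -> R) :
  open (domain S) ->
  int_domain S (fun p => \sum_(j <- s) H j (cell_at p)) =
  \sum_(j <- s) int_domain S (fun p => H j (cell_at p)).
Proof.
move=> oS; have mD := measurable_row_of_tuple_open oS.
rewrite /int_domain /lebesgue_integral_rV.
elim: s => [|j s ih].
  rewrite big_nil; under eq_Rintegral do rewrite big_nil.
  by rewrite Rintegral_cst // mul0r.
rewrite big_cons -ih; under eq_Rintegral do rewrite big_cons.
rewrite RintegralD //; first exact: integrable_cell_at.
exact: (integrable_cell_at (fun o => \sum_(j <- s) H j o)).
Qed.

Lemma int_domain_gt0 (H : option {set 'I_N} -> R) K :
  open (domain S) -> K \in cells S ->
  (forall o, 0 <= H o) -> 0 < H (Some K) ->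
  0 < int_domain S (fun p => H (cell_at p)).
Proof.
move=> oS KS H0 HK; have mD := measurable_row_of_tuple_open oS.
have [U [oU Ub UK]] :=
  simplex_interior (mesh_card mesh_S KS) (mesh_nondegenerate mesh_S KS).
(* The barycenter is only known to lie in the closure of the domain; its neighbourhood [U] supplies
   a point of the domain itself. *)
have [c [cS cU]] : domain S `&` U !=set0.
  have [w [w0 w1 wb]] := UK _ Ub.
  have : closure (domain S) (barycenter K).
    rewrite -(mesh_cover mesh_S); exists K => //.
    by exists w; split => // i /w0 /ltW.
  by apply; exact: open_nbhs_nbhs.
have [r r0 rU] : exists2 r : R, 0 < r & ball c r `<=` domain S `&` U.
  by apply/nbhs_ballP/open_nbhs_nbhs; split => //; exact: openI.
have mB := measurable_row_of_tuple_ball c r0.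
have iH := integrable_cell_at H oS.
(* [int_domain] is the finite part of an extended integral, so positivity also requires that
   integral to be below +oo. *)
apply: fine_gt0; apply/andP; split; last exact: integral_fune_lt_pinfty.
apply: (@lt_le_trans _ _ (\int[lebesgue_tuple R d]_(t in
    @row_of_tuple R d @^-1` ball c r) (H (cell_at (row_of_tuple t)))%:E)%E);
    last first.
  apply: ge0_subset_integral => //.
  - exact: measurable_int iH.
  - by move=> t _; rewrite lee_fin.
  - by move=> t /rU[].
rewrite (eq_integral (fun=> (H (Some K))%:E)) => [|t]; last first.
  rewrite inE => /rU[_ /UK[w [w0 w1 ->]]].
  by rewrite (cell_at_interior KS w0 w1).
rewrite integral_cst //; apply: mule_gt0; first by rewrite lte_fin.
suff : (0 < lebesgue_tuple R d (@row_of_tuple R d @^-1` ball c r))%E by [].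
by rewrite lebesgue_tuple_ball // lte_fin exprn_gt0 // pmulrn_lgt0.
Qed.

End Mesh.

(** * Stiffness matrix *)

Section Basis.
Context (R : realType) (d : nat) (S : wmc_data R d).
Context (mesh_S : conforming_simplex_mesh S) (basis_S : lagrange_basis S).
Local Notation N := (nvert S).
Implicit Types (i j : 'I_N) (K : {set 'I_N}).

(** On a cell the basis functions are the barycentric coordinates, both being affine with the same
    nodal values. *)
Lemma phi_weights K (w : 'I_N -> R) j : K \in cells S ->
  (forall i, i \in K -> 0 <= w i) -> \sum_(i in K) w i = 1 ->
  phi S j (\sum_(i in K) w i *: vertex S i) = if j \in K then w j else 0.
Proof.
move=> KS w0 w1; rewrite (affine_on_weights (lagrange_P1 basis_S j KS) w0 w1).
under eq_bigr do rewrite (lagrange_nodal basis_S).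
case: ifPn => jK.
  rewrite (bigD1 j) //= eqxx mulr1 big1 ?addr0 // => i /andP[_ /negPf ->].
  by rewrite mulr0.
rewrite big1 // => i iK; case: eqP => [ij|_]; last by rewrite mulr0.
by rewrite -ij iK in jK.
Qed.

Lemma phi_ge0 j p : closure (domain S) p -> 0 <= phi S j p.
Proof.
move=> /(closure_domain_cell mesh_S)[K KS [w [w0 w1 ->]]].
by rewrite (phi_weights _ KS w0 w1); case: ifP => // /w0.
Qed.

Lemma sum_phi K p : K \in cells S -> simplex K p -> \sum_j phi S j p = 1.
Proof.
move=> KS [w [w0 w1 ->]].
under eq_bigr do rewrite (phi_weights _ KS w0 w1).
by rewrite -big_mkcond.
Qed.

(** The value 0 off the mesh makes the identities below hold for every [o], not only for values of
    [cell_at]. *)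
Definition cell_grad (j : 'I_N) (o : option {set 'I_N}) : 'rV[R]_d :=
  if o is Some K then
    if K \in cells S then grad_on (simplex K) (phi S j) else 0
  else 0.

Lemma broken_grad_phi j p : broken_grad S (phi S j) p = cell_grad j (cell_at S p).
Proof.
by rewrite broken_gradE /cell_grad; case E: cell_at => [K|] //=; rewrite (cell_at_in E).
Qed.

Lemma cell_gradE j K p q : K \in cells S -> simplex K p -> simplex K q ->
  phi S j p - phi S j q = dotr (cell_grad j (Some K)) (p - q).
Proof.
by move=> KS; rewrite /cell_grad KS; apply/affine_on_grad/(lagrange_P1 basis_S).
Qed.

(** The basis functions form a partition of unity, whose gradient vanishes. *)
Lemma sum_cell_grad o : \sum_j cell_grad j o = 0.
Proof.
case: o => [K|]; last by rewrite big1.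
case: (boolP (K \in cells S)) => KS; last first.
  by rewrite big1 // => j _; rewrite /cell_grad (negPf KS).
apply: (simplex_spanning (mesh_card mesh_S KS) (mesh_nondegenerate mesh_S KS)).
move=> p q pK qK; rewrite dotr_suml.
under eq_bigr do rewrite -cell_gradE //.
by rewrite sumrB !(sum_phi KS) ?subrr.
Qed.

Lemma cell_grad_notin j K : j \notin K -> cell_grad j (Some K) = 0.
Proof.
move=> jK; case: (boolP (K \in cells S)) => KS; last by rewrite /cell_grad (negPf KS).
apply: (simplex_spanning (mesh_card mesh_S KS) (mesh_nondegenerate mesh_S KS)).
move=> p q [v [v0 v1 ->]] [w [w0 w1 ->]]; rewrite -cell_gradE //; last 2 first.
- by exists v.
- by exists w.
by rewrite !phi_weights // (negPf jK) subrr.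
Qed.

Context (d_gt0 : (0 < d)%N).

(** The basis function drops from 1 at x_j to 0 at another vertex of [K], which exists because d+1
    is at least 2. *)
Lemma cell_grad_neq0 j K : K \in cells S -> j \in K -> cell_grad j (Some K) != 0.
Proof.
move=> KS jK; apply/eqP => g0.
have [k kK kj] : exists2 k, k \in K & k != j.
  have : (0 < #|K :\ j|)%N.
    by have := cardsD1 j K; rewrite (mesh_card mesh_S KS) jK add1n => -[<-].
  by case/card_gt0P => k; rewrite !inE => /andP[kj kK]; exists k.
have := @cell_gradE j K (vertex S j) (vertex S k) KS.
rewrite g0 dotr0l !(lagrange_nodal basis_S) eqxx (negPf kj) subr0 => h.
have /eqP := h (simplex_vertex jK) (simplex_vertex kK).
by rewrite oner_eq0.
Qed.

Lemma nbr'P i j : j \in nbr' i <->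
  j != i /\ exists2 K, K \in cells S & (i \in K) && (j \in K).
Proof.
rewrite !inE; split => [/andP[ji /existsP[K /andP[KS h]]]|[-> [K KS h]]].
  by split => //; exists K.
by apply/existsP; exists K; rewrite KS.
Qed.

Lemma nbr'_sym i j : j \in nbr' i -> i \in nbr' j.
Proof.
move=> /nbr'P[ji [K KS h]]; apply/nbr'P; rewrite eq_sym.
by split => //; exists K => //; rewrite andbC.
Qed.

(** * Row sums and signs of the stiffness matrix *)

Context (domain_open : open (domain S)).
Context (eps_gt0 : 0 < eps S).

Lemma aDE i j : aD i j =
  eps S * int_domain S (fun p => dotr (cell_grad i (cell_at S p))
                                      (cell_grad j (cell_at S p))).
Proof.
congr (_ * int_domain S _); apply/funext => p.
by rewrite !broken_grad_phi.
Qed.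

Lemma int_domain0 : int_domain S (fun=> 0) = 0.
Proof.
have := int_domain_sum mesh_S [::] (fun (_ : void) _ => 0) domain_open.
by rewrite !big_nil.
Qed.

Lemma sum_aD i : \sum_j aD i j = 0.
Proof.
under eq_bigr do rewrite aDE; rewrite -mulr_sumr.
rewrite -(int_domain_sum mesh_S _
  (fun j o => dotr (cell_grad i o) (cell_grad j o)) domain_open).
rewrite (_ : (fun p => _) = fun=> 0) ?int_domain0 ?mulr0 //.
by apply/funext => p; rewrite -dotr_sumr sum_cell_grad dotr0r.
Qed.

Lemma aD_diag_gt0 i : 0 < aD i i.
Proof.
have [K KS iK] := mesh_vertices mesh_S i.
rewrite aDE mulr_gt0 //.
apply: (int_domain_gt0 mesh_S domain_open KS
  (H := fun o => dotr (cell_grad i o) (cell_grad i o))).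
  by move=> o; exact: dotr_ge0.
rewrite lt_def dotr_ge0 andbT; apply: contra (cell_grad_neq0 KS iK) => /eqP.
by move/dotr_eq0 => ->.
Qed.

Lemma aD_nonnbr i j : i != j -> j \notin nbr' i -> aD i j = 0.
Proof.
move=> ij jN; rewrite aDE (_ : (fun p => _) = fun=> 0) ?int_domain0 ?mulr0 //.
apply/funext => p; case E: (cell_at S p) => [K|]; last by rewrite dotr0l.
case: (boolP (i \in K)) => iK; last by rewrite cell_grad_notin // dotr0l.
case: (boolP (j \in K)) => jK; last by rewrite [X in dotr _ X]cell_grad_notin // dotr0r.
case/negP: jN; apply/nbr'P; split; first by rewrite eq_sym.
by exists K; rewrite ?(cell_at_in E) ?iK.
Qed.

(** A zero row sum with a positive diagonal entry needs a negative entry, and entries outside the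
    neighbourhood vanish. In particular [nbr' i] is nonempty. *)
Lemma exists_aD_lt0 i : exists2 j, j \in nbr' i & aD i j < 0.
Proof.
apply/exists2P/not_existsP => h.
have := sum_aD i; rewrite (bigD1 i) //= => /eqP; apply/negP.
rewrite gt_eqF // ltr_wpDr ?aD_diag_gt0 // sumr_ge0 // => j ji.
case: (boolP (j \in nbr' i)) => jN; last by rewrite aD_nonnbr // eq_sym.
by rewrite leNgt; apply/negP => lt0; exact: (h j).
Qed.

Context (reac_ge0 : forall p, closure (domain S) p -> 0 <= reac S p).

Lemma aRsum_ge0 i : 0 <= aRsum i.
Proof.
apply: sumr_ge0 => j _; apply: Rintegral_ge0 => t /subset_closure tS.
by rewrite !mulr_ge0 ?reac_ge0 ?phi_ge0.
Qed.

End Basis.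

(** * Limiters and the maximum principle *)

Section MaxMinOver.
Context (R : realType) (I : finType) (A : {set I}) (F : I -> R).

Lemma le_max_over j : j \in A -> F j <= max_over A F.
Proof.
move=> jA; rewrite /max_over; case: pickP => [k _|/(_ j)]; last by rewrite jA.
exact: le_bigmax_cond.
Qed.

Lemma min_over_le j : j \in A -> min_over A F <= F j.
Proof.
move=> jA; rewrite /min_over; case: pickP => [k _|/(_ j)]; last by rewrite jA.
exact: bigmin_le_cond.
Qed.

Lemma max_over_le j m : j \in A -> (forall k, k \in A -> F k <= m) ->
  max_over A F <= m.
Proof.
move=> jA h; rewrite /max_over; case: pickP => [k kA|/(_ j)]; last by rewrite jA.
by apply: bigmax_le => //; exact: h.
Qed.

Lemma le_min_over j m : j \in A -> (forall k, k \in A -> m <= F k) ->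
  m <= min_over A F.
Proof.
move=> jA h; rewrite /min_over; case: pickP => [k kA|/(_ j)]; last by rewrite jA.
by apply: le_bigmin => //; exact: h.
Qed.

End MaxMinOver.

Section Scheme.
Context (R : realType) (d : nat) (S : wmc_data R d).
Local Notation N := (nvert S).
Implicit Types (i j : 'I_N) (K : {set 'I_N}) (u : 'cV[R]_N).

Lemma normr_aC_le i j : j \in nbr' i -> `|aC i j| <= visc i j.
Proof.
move=> jN; have /nbr'P[ji _] := jN.
by rewrite /visc eq_sym (negPf ji) /visc_off jN le_max lexx.
Qed.

Lemma visc_ge0 i j : j \in nbr' i -> 0 <= visc i j.
Proof. by move/normr_aC_le; apply: le_trans. Qed.

Lemma aCsum_ge0 i : 0 <= aCsum i.
Proof. by apply: sumr_ge0 => j /visc_ge0 h; rewrite mulr_ge0. Qed.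

(** With r = a_ij^C / d_ij in [-1, 1], [ubar] is the convex combination of u_i and u_j with weights
    (1 + r)/2 and (1 - r)/2. *)
Lemma ubar_bounds u i j : j \in nbr' i ->
  Num.min (u i 0) (u j 0) <= ubar u i j <= Num.max (u i 0) (u j 0).
Proof.
move=> /normr_aC_le; rewrite /ubar; move: (aC i j) (visc i j) => a v av.
have [r /andP[r1 r2] ->] : exists2 r : R, -1 <= r <= 1 &
    a * (u j 0 - u i 0) / (2 * v) = r * (u j 0 - u i 0) / 2.
  exists (a / v); last by rewrite invfM; ring.
  (* For [v = 0] the inverse is 0 by convention, so the ratio is 0. *)
  rewrite -ler_norml normrM normfV; have [->|v0] := eqVneq v 0.
    by rewrite normr0 invr0 mulr0.
  rewrite ler_pdivrMr ?normr_gt0 // mul1r.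
  by apply: le_trans av _; exact: ler_norm.
move: (u i 0) (u j 0) => x y.
by case: (leP x y) => xy; apply/andP; split; nra.
Qed.

Lemma load_aCsum_le0 i : load i <= 0 -> load i / aCsum i <= 0.
Proof. by move=> b0; rewrite mulr_le0_ge0 // invr_ge0 aCsum_ge0. Qed.

Lemma load_aCsum_ge0 i : 0 <= load i -> 0 <= load i / aCsum i.
Proof. by move=> b0; rewrite divr_ge0 // aCsum_ge0. Qed.

Lemma Qp_ge0 u i j : j \in nbr' i -> load i <= 0 -> 0 <= Qp u i j.
Proof.
move=> jN /load_aCsum_le0 b0; have /andP[_ h] := ubar_bounds u jN.
by rewrite le_max; apply/orP; right; lra.
Qed.

Lemma Qm_le0 u i j : j \in nbr' i -> 0 <= load i -> Qm u i j <= 0.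
Proof.
move=> jN /load_aCsum_ge0 b0; have /andP[h _] := ubar_bounds u jN.
by rewrite ge_min; apply/orP; right; lra.
Qed.

(** Whenever the ratio Q/P is used, Q is zero or has the sign of P, and |Q| < |P|. *)
Lemma Rlim_01 u i j : j \in nbr' i -> 0 <= Rlim u i j <= 1.
Proof.
move=> jN; rewrite /Rlim; case: ifP => _; last by rewrite ler01 lexx.
case: ifP => [/andP[/(Qp_ge0 u jN) Q0 QP]|_].
  have P0 := le_lt_trans Q0 QP.
  by rewrite divr_ge0 ?(ltW P0) //= ler_pdivrMr // mul1r ltW.
case: ifP => [/andP[/(Qm_le0 u jN) Q0 QP]|_]; last by rewrite ler01 lexx.
have P0 := lt_le_trans QP Q0.
by rewrite ler_ndivlMr // mul0r Q0 ler_ndivrMr // mul1r ltW.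
Qed.

Lemma alpha_01 u i j : j \in nbr' i -> 0 <= alpha u i j <= 1.
Proof.
move=> jN; have /andP[h1 h2] := Rlim_01 u jN.
have /andP[h3 _] := Rlim_01 u (nbr'_sym jN).
by rewrite le_min ge_min h1 h2 h3.
Qed.

(** For P <= 0 the sign of [Qp] suffices, for 0 < P <= Q+ the bound alpha <= 1, and otherwise alpha
    <= Q+/P. *)
Lemma alphaP_le_Qp u i j : (i < nfree S)%N -> j \in nbr' i -> load i <= 0 ->
  alpha u i j * P_wb u i j <= Qp u i j.
Proof.
move=> i_free jN b0; have Q0 := Qp_ge0 u jN b0.
have /andP[a0 a1] := alpha_01 u jN.
have [P0|P0] := leP (P_wb u i j) 0.
  by apply: le_trans Q0; rewrite mulr_ge0_le0.
have [PQ|QP] := leP (P_wb u i j) (Qp u i j).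
  by apply: le_trans PQ; rewrite ler_piMl // ltW.
rewrite -ler_pdivlMr //.
have : alpha u i j <= Rlim u i j by rewrite ge_min lexx.
by rewrite /Rlim i_free b0 QP.
Qed.

Lemma Qm_le_alphaP u i j : (i < nfree S)%N -> j \in nbr' i -> 0 <= load i ->
  Qm u i j <= alpha u i j * P_wb u i j.
Proof.
move=> i_free jN b0; have Q0 := Qm_le0 u jN b0.
have /andP[a0 a1] := alpha_01 u jN.
have [P0|P0] := leP 0 (P_wb u i j).
  by apply: le_trans Q0 _; rewrite mulr_ge0.
have [QP|PQ] := leP (Qm u i j) (P_wb u i j).
  by apply: le_trans QP _; nra.
rewrite -ler_ndivlMr //.
have : alpha u i j <= Rlim u i j by rewrite ge_min lexx.
(* If b_i = 0 the first branch of [Rlim] has to be excluded: it would require Q+ < P < 0. *)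
rewrite /Rlim i_free b0 PQ; case: ifP => // /andP[b0' QP].
have := Qp_ge0 u jN b0'; lra.
Qed.

(** A positive flux is limited by this very bound; otherwise the limited flux is nonpositive and the
    bound nonnegative. *)
Lemma f_s_star_le u i j : j \in nbr' i ->
  f_s_star u i j <= 2 * visc i j * (ubar_max u i - ubar_s u i j).
Proof.
move=> jN; have v0 : 0 <= 2 * visc i j by rewrite mulr_ge0 ?visc_ge0.
have m0 : 0 <= 2 * visc i j * (ubar_max u i - ubar_s u i j).
  by rewrite mulr_ge0 // subr_ge0 (le_max_over (ubar_s u i)).
rewrite /f_s_star; case: eqP => // f0; case: ltP => f1.
  by case: ifP => _; rewrite !ge_min lexx ?orbT.
apply: le_trans m0; case: ifP => _; rewrite !ge_max f1 /=.
  apply/andP; split; rewrite mulr_ge0_le0 // subr_le0.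
    exact: (min_over_le (ubar_s u i)).
  exact: (le_max_over (ubar_s u j)) (nbr'_sym jN).
by rewrite mulr_ge0_le0 // subr_le0 (min_over_le (ubar_s u i)).
Qed.

Lemma f_s_star_ge u i j : j \in nbr' i ->
  2 * visc i j * (ubar_min u i - ubar_s u i j) <= f_s_star u i j.
Proof.
move=> jN; have v0 : 0 <= 2 * visc i j by rewrite mulr_ge0 ?visc_ge0.
have m0 : 2 * visc i j * (ubar_min u i - ubar_s u i j) <= 0.
  by rewrite mulr_ge0_le0 // subr_le0 (min_over_le (ubar_s u i)).
rewrite /f_s_star; case: eqP => // f0; case: ltP => f1.
  apply: le_trans m0 _; case: ifP => _; rewrite !le_min (ltW f1) /=.
    apply/andP; split; rewrite mulr_ge0 // subr_ge0.
      exact: (le_max_over (ubar_s u i)).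
    exact: (min_over_le (ubar_s u j)) (nbr'_sym jN).
  by rewrite mulr_ge0 // subr_ge0 (le_max_over (ubar_s u i)).
by case: ifP => _; rewrite !le_max lexx ?orbT.
Qed.

Lemma ubar_s_star_le u i j : j \in nbr' i -> ubar_s_star u i j <= ubar_max u i.
Proof.
move=> jN; rewrite /ubar_s_star -lerBrDl; have := visc_ge0 jN.
rewrite le_eqVlt => /predU1P[<-|v0].
  by rewrite mulr0 invr0 mulr0 subr_ge0 (le_max_over (ubar_s u i)).
by rewrite ler_pdivrMr ?mulr_gt0 // mulrC f_s_star_le.
Qed.

Lemma ubar_s_star_ge u i j : j \in nbr' i -> ubar_min u i <= ubar_s_star u i j.
Proof.
move=> jN; rewrite /ubar_s_star -lerBlDl; have := visc_ge0 jN.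
rewrite le_eqVlt => /predU1P[<-|v0].
  by rewrite mulr0 invr0 mulr0 subr_le0 (min_over_le (ubar_s u i)).
by rewrite ler_pdivlMr ?mulr_gt0 // mulrC f_s_star_ge.
Qed.

(** * Extrapolated values at a local extremum *)

Context (mesh_S : conforming_simplex_mesh S) (basis_S : lagrange_basis S).
Context (ext_cell_S : ext_cell_spec S).

Lemma fe_fun_affine u K : K \in cells S -> affine_on (simplex K) (fe_fun u).
Proof.
move=> KS.
have /choice[g gP] j : exists gb : 'rV[R]_d * R, forall p, simplex K p ->
    phi S j p = dotr gb.1 p + gb.2.
  by have [g [b h]] := lagrange_P1 basis_S j KS; exists (g, b).
exists (\sum_j u j 0 *: (g j).1), (\sum_j u j 0 * (g j).2) => p pK.
rewrite dotr_suml -big_split; apply: eq_bigr => j _.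
by rewrite gP // dotrZl mulrDr.
Qed.

Lemma fe_fun_vertex u i : fe_fun u (vertex S i) = u i 0.
Proof.
rewrite /fe_fun (bigD1 i) //= (lagrange_nodal basis_S) eqxx mulr1.
rewrite big1 ?addr0 // => j ji.
by rewrite (lagrange_nodal basis_S) eq_sym (negPf ji) mulr0.
Qed.

(** The half line meets the cell at q = x_i + t (x_i - x_j). As u_h is affine there, t (u_j^i - u_i)
    = u_h(q) - u_h(x_i), and q is a convex combination of vertices near x_i. The sign of u_j^i - u_i
    can then be read off at an extremum. *)
Lemma u_ext_weights u i j : (i < nfree S)%N -> j \in nbr' i ->
  exists t K (w : 'I_N -> R), [/\ 0 < t,
    forall k, k \in K -> k \in nbr i /\ 0 <= w k &
    t * (u_ext u i j - u i 0) = \sum_(k in K) w k * (u k 0 - u i 0)].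
Proof.
move=> i_free jN; have [KS iK [t t0 qK]] := ext_cell_S i_free jN.
have feK := fe_fun_affine u KS.
have := affine_on_grad feK qK (simplex_vertex iK).
rewrite addrAC subrr add0r dotrZr fe_fun_vertex.
have [w [w0 w1 ->]] := qK.
rewrite (affine_on_weights feK w0 w1) => e.
exists t, (ext_cell S i j), w; split=> //.
  move=> k kK; split; last exact: w0.
  by rewrite inE; apply/existsP; exists (ext_cell S i j); rewrite KS iK.
rewrite /u_ext addrAC subrr add0r -e -[u i 0]mul1r -[in LHS]w1 mulr_suml -sumrB.
by apply: eq_bigr => k _; rewrite fe_fun_vertex mulrBr mul1r.
Qed.

Lemma u_ext_le u i j : (i < nfree S)%N -> j \in nbr' i ->
  (forall k, k \in nbr' i -> u k 0 <= u i 0) -> u_ext u i j <= u i 0.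
Proof.
move=> i_free jN um; have [t [K [w [t0 wK e]]]] := u_ext_weights u i_free jN.
rewrite -subr_le0 -(pmulr_rle0 _ t0) e; apply: sumr_le0 => k /wK[kN w0].
rewrite mulr_ge0_le0 // subr_le0; have [->//|ki] := eqVneq k i.
by apply: um; rewrite inE inE ki.
Qed.

Lemma u_ext_ge u i j : (i < nfree S)%N -> j \in nbr' i ->
  (forall k, k \in nbr' i -> u i 0 <= u k 0) -> u i 0 <= u_ext u i j.
Proof.
move=> i_free jN um; have [t [K [w [t0 wK e]]]] := u_ext_weights u i_free jN.
rewrite -subr_ge0 -(pmulr_rge0 _ t0) e; apply: sumr_ge0 => k /wK[kN w0].
rewrite mulr_ge0 // subr_ge0; have [->//|ki] := eqVneq k i.
by apply: um; rewrite inE inE ki.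
Qed.

(* At a local maximum the first argument of the maximum defining [Qp] is
   nonpositive while the second one is nonnegative. *)
Lemma ubar_s_le u i j : (i < nfree S)%N -> j \in nbr' i -> load i <= 0 ->
  (forall k, k \in nbr' i -> u k 0 <= u i 0) -> ubar_s u i j <= u i 0.
Proof.
move=> i_free jN b0 um; have := alphaP_le_Qp u i_free jN b0.
have := u_ext_le i_free jN um; have := load_aCsum_le0 b0.
have /andP[_] := ubar_bounds u jN; rewrite /Qp /ubar_s (max_l (um j jN)).
by move=> h1 h2 h3; rewrite le_max => /orP[]; lra.
Qed.

Lemma ubar_s_ge u i j : (i < nfree S)%N -> j \in nbr' i -> 0 <= load i ->
  (forall k, k \in nbr' i -> u i 0 <= u k 0) -> u i 0 <= ubar_s u i j.
Proof.
move=> i_free jN b0 um; have := Qm_le_alphaP u i_free jN b0.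
have := u_ext_ge i_free jN um; have := load_aCsum_ge0 b0.
have /andP[+ _] := ubar_bounds u jN; rewrite /Qm /ubar_s (min_l (um j jN)).
by move=> h1 h2 h3; rewrite ge_min => /orP[]; lra.
Qed.

(** * The scheme at a strict local extremum *)

Context (d_gt0 : (0 < d)%N) (domain_open : open (domain S)).
Context (eps_gt0 : 0 < eps S) (aD_le0 : offdiag_diffusion_nonpos S).
Context (u : 'cV[R]_N) (u_sol : wmc_solution u).

Lemma strict_local_max_aRsum_lt0 i : (i < nfree S)%N -> load i <= 0 ->
  (forall j, j \in nbr' i -> u j 0 < u i 0) -> aRsum i * u i 0 < 0.
Proof.
move=> i_free b0 um.
have [j0 j0N aD0] := exists_aD_lt0 mesh_S basis_S d_gt0 domain_open eps_gt0 i.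
have umax : ubar_max u i <= u i 0.
  apply: (max_over_le j0N) => j jN; apply: ubar_s_le => // k kN.
  exact/ltW/um.
have flux_le0 j : j \in nbr' i -> 2 * visc i j * (ubar_s_star u i j - u i 0) <= 0.
  move=> jN; rewrite mulr_ge0_le0 ?mulr_ge0 ?visc_ge0 // subr_le0.
  exact: le_trans (ubar_s_star_le u jN) umax.
have /eqP := (u_sol.1 i i_free); rewrite subr_eq0 => /eqP ->.
(* Strictness comes from the [j0] term alone; the other terms are only nonpositive. *)
rewrite (bigD1 j0) //= -[ltRHS]addr0 ltr_leD //.
  have := flux_le0 _ j0N; have := um _ j0N; nra.
apply: sumr_le0 => j /andP[jN _].
have ij : i != j by case/nbr'P: jN; rewrite eq_sym.
have := flux_le0 _ jN; have := um _ jN; have := aD_le0 ij; nra.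
Qed.

Lemma strict_local_min_aRsum_gt0 i : (i < nfree S)%N -> 0 <= load i ->
  (forall j, j \in nbr' i -> u i 0 < u j 0) -> 0 < aRsum i * u i 0.
Proof.
move=> i_free b0 um.
have [j0 j0N aD0] := exists_aD_lt0 mesh_S basis_S d_gt0 domain_open eps_gt0 i.
have umin : u i 0 <= ubar_min u i.
  apply: (le_min_over j0N) => j jN; apply: ubar_s_ge => // k kN.
  exact/ltW/um.
have flux_ge0 j : j \in nbr' i -> 0 <= 2 * visc i j * (ubar_s_star u i j - u i 0).
  move=> jN; rewrite mulr_ge0 ?mulr_ge0 ?visc_ge0 // subr_ge0.
  exact: le_trans umin (ubar_s_star_ge u jN).
have /eqP := (u_sol.1 i i_free); rewrite subr_eq0 => /eqP ->.
rewrite (bigD1 j0) //= -[ltLHS]addr0 ltr_leD //.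
  have := flux_ge0 _ j0N; have := um _ j0N; nra.
apply: sumr_ge0 => j /andP[jN _].
have ij : i != j by case/nbr'P: jN; rewrite eq_sym.
have := flux_ge0 _ jN; have := um _ jN; have := aD_le0 ij; nra.
Qed.

End Scheme.

Theorem theorem2 (R : realType) (d : nat) (hd : (0 < d <= 3)%N)
    (S : wmc_data R d)
    (domain_lipschitz : lipschitz_domain (domain S))
    (eps_gt0 : 0 < eps S)
    (reac_ge0 : forall p, closure (domain S) p -> 0 <= reac S p)
    (mesh_S : conforming_simplex_mesh S)
    (basis_S : lagrange_basis S)
    (numbering_S : dirichlet_numbering S)
    (delta_gt0 : 0 < delta S)
    (aD_le0 : offdiag_diffusion_nonpos S)
    (vel_neq0 : velocity_nonvanishing S)
    (ext_cell_S : ext_cell_spec S)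
    (u : 'cV[R]_(nvert S))
    (u_sol : wmc_solution u)
    (i : 'I_(nvert S)) (i_free : (i < nfree S)%N) :
  ((load i <= 0 -> u i 0 <= max_over (nbr' i) (fun j => Num.max (u j 0) 0)) /\
   (0 <= load i -> min_over (nbr' i) (fun j => Num.min (u j 0) 0) <= u i 0)) /\
  (aRsum i = 0 ->
   (load i <= 0 -> u i 0 <= max_over (nbr' i) (fun j => u j 0)) /\
   (0 <= load i -> min_over (nbr' i) (fun j => u j 0) <= u i 0)).
Proof.
have /andP[d_gt0 _] := hd; have [_ domain_open _ _] := domain_lipschitz.
have a0 := aRsum_ge0 mesh_S basis_S reac_ge0 i.
have [j0 j0N _] := exists_aD_lt0 mesh_S basis_S d_gt0 domain_open eps_gt0 i.
have maxP := strict_local_max_aRsum_lt0 mesh_S basis_S ext_cell_S d_gt0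
  domain_open eps_gt0 aD_le0 u_sol i_free.
have minP := strict_local_min_aRsum_gt0 mesh_S basis_S ext_cell_S d_gt0
  domain_open eps_gt0 aD_le0 u_sol i_free.
split; [|move=> aR0]; split => b0; rewrite leNgt; apply/negP => lt_u.
- pose F j : R := Num.max (u j 0) 0.
  (* Exceeding the positive part at the neighbour [j0] already forces u_i to be nonnegative, which
     contradicts a_i^R u_i < 0. *)
  have u0 : 0 <= u i 0.
    apply: ltW; apply: le_lt_trans lt_u.
    by apply: le_trans (le_max_over F j0N); rewrite le_max lexx orbT.
  suff : aRsum i * u i 0 < 0 by rewrite ltNge mulr_ge0.
  apply: maxP => // j jN.
  apply: le_lt_trans lt_u; apply: le_trans (le_max_over F jN).
  by rewrite le_max lexx.
- pose F j : R := Num.min (u j 0) 0.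
  have u0 : u i 0 <= 0.
    apply: ltW; apply: lt_le_trans lt_u _.
    by apply: le_trans (min_over_le F j0N) _; rewrite ge_min lexx orbT.
  suff : 0 < aRsum i * u i 0 by rewrite ltNge mulr_ge0_le0.
  apply: minP => // j jN.
  apply: lt_le_trans lt_u _; apply: le_trans (min_over_le F jN) _.
  by rewrite ge_min lexx.
- suff : aRsum i * u i 0 < 0 by rewrite aR0 mul0r ltxx.
  apply: maxP => // j jN.
  exact: le_lt_trans (le_max_over (fun j => u j 0) jN) lt_u.
- suff : 0 < aRsum i * u i 0 by rewrite aR0 mul0r ltxx.
  apply: minP => // j jN.
  exact: lt_le_trans lt_u (min_over_le (fun j => u j 0) jN).
Qed.
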